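(* Let $d,n_1,\dots,n_d$ be positive integers, $\Omega\subseteq\mathcal{G}=[n_1]\times\dots\times[n_d]$, and $\hat T\in\mathbb{R}^\Omega$, and suppose that the exact rank-one completion problem for $(\Omega,\hat T)$ has a unique solution. Assume that $\Omega$ satisfies S-propagation and that the values $(\hat T_\alpha)_{\alpha\in\Omega}$ are all nonzero. Then there exists $t\in(0,1)$ such that for any $\vartheta\in(0,t)$ the relaxation (SDP-E$^w$) is tight for the weight vector $w=w(\Omega,\vartheta)$ generated by the weight-generation procedure with input $\Omega$ and $\vartheta$.
   Context: Notation: $[m]=\{1,\dots,m\}$; $N=n_1\cdots n_d$; $\mathcal{G}=[n_1]\times\dots\times[n_d]$; coordinates of $\mathbb{R}^N$ are indexed by $\mathcal{G}$, and $\mathbb{S}^N$ is the space of real symmetric $N\times N$ matrices (rows and columns indexed by $\mathcal{G}$). Exact rank-one completion problem for $(\Omega,\hat T)$: find a rank-one tensor $T\in\mathbb{R}^{n_1\times\dots\times n_d}$ (nonzero, of the form $T_{i_1,\dots,i_d}=\prod_k u^{(k)}_{i_k}$) with $T_\alpha=\hat T_\alpha$ for all $\alpha\in\Omega$. Square: $\{\alpha_1,\alpha_2;\alpha_3,\alpha_4\}$ is a square if $\alpha_1,\dots,\alpha_4\in\mathcal{G}$ are distinct and for every $k\in[d]$, $\max\{(\alpha_1)_k,(\alpha_2)_k\}=\max\{(\alpha_3)_k,(\alpha_4)_k\}$ and $\min\{(\alpha_1)_k,(\alpha_2)_k\}=\min\{(\alpha_3)_k,(\alpha_4)_k\}$.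 Let $\mathcal{A}$ be the set of all squares. S-propagation: let $\mathcal{P}_{S}(\Omega)$ be the smallest set containing $\Omega$ such that if $\{\alpha_1,\alpha_2;\alpha_3,\beta\}$ is a square with $\alpha_1,\alpha_2,\alpha_3\in\mathcal{P}_S(\Omega)$, then $\beta\in\mathcal{P}_S(\Omega)$. $\Omega$ satisfies S-propagation if $\mathcal{P}_S(\Omega)=\mathcal{G}$. SR-propagated set: $\mathcal{P}_{SR}(\Omega)$ is the smallest set containing $\Omega$ such that if $\{\alpha_1,\beta;\alpha_2,\gamma\}$ is a square with $\alpha_1,\alpha_2\in\Omega$ and $\beta\in\mathcal{P}_{SR}(\Omega)$, then $\gamma\in\mathcal{P}_{SR}(\Omega)$. Weight-generation procedure (input: $\Omega$ satisfying S-propagation, $\vartheta\in(0,1)$): put $\mathcal{P}_0=\mathcal{P}_{SR}(\Omega)$ and, for $\ell\ge1$, let $B_\ell$ be the set of $\beta\in\mathcal{G}\setminus\mathcal{P}_{\ell-1}$ such that $\{\alpha_i,\alpha_j;\alpha_k,\beta\}$ is a square for some $\alpha_i,\alpha_j,\alpha_k\in\mathcal{P}_{\ell-1}$, and $\mathcal{P}_\ell=\mathcal{P}_{\ell-1}\cup B_\ell$; stop when $\mathcal{P}_\ell=\mathcal{G}$. The output weights are $w_\beta=1$ for $\beta\in\mathcal{P}_{SR}(\Omega)$ and $w_\beta=\vartheta^\ell$ for $\beta\in B_\ell$. (SDP-E$^w$), for a weight vector $w\in\mathbb{R}^N$: minimize $\sum_{\beta\in\mathcal{G}}w_\beta X_{\beta,\beta}$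 over $x\in\mathbb{R}^N$, $X\in\mathbb{S}^N$ subject to $x_\alpha=\hat T_\alpha$ and $X_{\alpha,\alpha}=\hat T_\alpha^2$ for all $\alpha\in\Omega$; $X_{\alpha_1,\alpha_2}=X_{\alpha_3,\alpha_4}$ for all $\{\alpha_1,\alpha_2;\alpha_3,\alpha_4\}\in\mathcal{A}$; and $\mathbf{X}:=\begin{pmatrix}1 & x^T \\ x & X\end{pmatrix}\succeq0$. Tight: let $T$ be the unique completion and $\bar x\in\mathbb{R}^N$ the vector with $\bar x_\beta=T_\beta$. The relaxation is tight if it has a unique optimal solution, namely the rank-one matrix $\bar{\mathbf{X}}=\begin{pmatrix}1 & \bar x^T \\ \bar x & \bar x\bar x^T\end{pmatrix}$. *)

(* Defs.v *)
From mathcomp Require Import all_boot all_order all_algebra.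
From mathcomp Require Import reals.

Set Implicit Arguments.
Unset Strict Implicit.
Unset Printing Implicit Defensive.

Import Order.TTheory GRing.Theory Num.Theory.
Local Open Scope ring_scope.

(* Multi-indices of an [n_1] x ... x [n_d] tensor.  Indices start at 0; only
   their relative order within each coordinate is ever used. *)
Notation grid n := {dffun forall k, 'I_(n k)}.

Section Combinatorics.

Variables (d : nat) (n : 'I_d -> nat).
Implicit Types (P Omega : {set grid n}) (a b c : grid n).

(* {a1, a2; a3, a4} *)
Definition is_square (a1 a2 a3 a4 : grid n) : bool :=
  uniq [:: a1; a2; a3; a4] &&
  [forall k, (maxn (a1 k) (a2 k) == maxn (a3 k) (a4 k))
          && (minn (a1 k) (a2 k) == minn (a3 k) (a4 k))].

Definition S_closed P : bool :=
  [forall a1 in P, forall a2 in P, forall a3 in P, forall b,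
     is_square a1 a2 a3 b ==> (b \in P)].

Definition S_propagated Omega : {set grid n} :=
  \bigcap_(P : {set grid n} | (Omega \subset P) && S_closed P) P.

Definition S_propagation Omega : Prop := S_propagated Omega = setT.

Definition SR_closed Omega P : bool :=
  [forall a1 in Omega, forall a2 in Omega, forall b in P, forall c,
     is_square a1 b a2 c ==> (c \in P)].

Definition SR_propagated Omega : {set grid n} :=
  \bigcap_(P : {set grid n} | (Omega \subset P) && SR_closed Omega P) P.

Definition S_step P : {set grid n} :=
  [set b | (b \notin P) &&
     [exists a1 in P, exists a2 in P, exists a3 in P, is_square a1 a2 a3 b]].

Definition stage Omega (l : nat) : {set grid n} :=
  iter l (fun P => P :|: S_step P) (SR_propagated Omega).

(* The first l with b in [stage Omega l]; the stages are stationary from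
   #|grid n| on, so the search may be bounded.  If b is in no stage (impossible
   under S-propagation), this is the irrelevant value #|grid n|.+1. *)
Definition level Omega b : nat :=
  find (fun l => b \in stage Omega l) (iota 0 #|{: grid n}|.+1).

Definition weights (R : realType) Omega (theta : R) (b : grid n) : R :=
  theta ^+ level Omega b.

Lemma stage_sub Omega l m : (l <= m)%N -> stage Omega l \subset stage Omega m.
Proof.
move=> /subnKC <-; elim: (m - l)%N => [|i IH]; first by rewrite addn0.
by rewrite addnS (subset_trans IH) // subsetUl.
Qed.

Lemma stage_card Omega l : S_step (stage Omega l) != set0 ->
  (l < #|stage Omega l.+1|)%N.
Proof.
have lt m : S_step (stage Omega m) != set0 ->
    (#|stage Omega m| < #|stage Omega m.+1|)%N.
  case/set0Pn=> b bS; apply/proper_card/properP; split; first exact: stage_sub.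
  exists b; first by rewrite in_setU bS orbT.
  by move: bS; rewrite inE => /andP[].
elim: l => [|l IH] ne; first exact: leq_ltn_trans (lt _ ne).
apply: leq_ltn_trans (lt _ ne); apply: IH.
apply: contraNneq ne => e0.
by rewrite /stage iterS -/(stage Omega l) e0 setU0 e0.
Qed.

Lemma weights_SR (R : realType) Omega (theta : R) b :
  b \in SR_propagated Omega -> weights Omega theta b = 1.
Proof. by move=> bSR; rewrite /weights /level /= bSR expr0. Qed.

Lemma weights_step (R : realType) Omega (theta : R) l b :
  b \in S_step (stage Omega l) -> weights Omega theta b = theta ^+ l.+1.
Proof.
move=> bS; rewrite /weights /level; congr (_ ^+ _).
have lt : (l.+1 < #|{: grid n}|.+1)%N.
  rewrite ltnS; apply: leq_trans (max_card (mem (stage Omega l.+1))).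
  by apply: stage_card; apply/set0Pn; exists b.
have bl : b \in stage Omega l.+1 by rewrite in_setU bS orbT.
have bNl m : (m <= l)%N -> b \notin stage Omega m.
  move=> ml; move: bS; rewrite inE => /andP[bN _].
  by apply: contra bN; apply: (subsetP (stage_sub Omega ml)).
set p := fun _ => _; set s := iota _ _.
have hs : has p s.
  by apply/hasP; exists l.+1; rewrite ?mem_iota.
have fs : (find p s < #|{: grid n}|.+1)%N by move: hs; rewrite has_find size_iota.
apply/eqP; rewrite eqn_leq; apply/andP; split.
  rewrite leqNgt; apply/negP => /(before_find 0%N).
  by rewrite nth_iota // /p bl.
rewrite ltnNge; apply/negP => /bNl.
by have := nth_find 0%N hs; rewrite nth_iota // /p add0n => ->.
Qed.

End Combinatorics.

Section Relaxation.

Variables (R : realType) (d : nat) (n : 'I_d -> nat).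
Implicit Types (T : {ffun grid n -> R}).

Definition rank_one T : Prop :=
  T <> [ffun => 0] /\
  exists u : forall k, 'I_(n k) -> R, forall a, T a = \prod_k u k (a k).

Definition rank_one_completion (Omega : {set grid n})
    (That : {a | a \in Omega} -> R) T : Prop :=
  rank_one T /\ forall a, T (val a) = That a.

Definition psd m (A : 'M[R]_m) : Prop :=
  A^T = A /\ forall v : 'cV[R]_m, 0 <= (v^T *m A *m v) 0 0.

(* R^N and S^N are rendered as vectors and matrices of size N = #|grid n|; the
   bijection enum_rank supplies the indexing by multi-indices. *)
Local Notation N := #|{: grid n}|.
Local Notation "x .<[ a ]>" := (x (enum_rank a) 0)
  (at level 2, format "x .<[ a ]>").
Local Notation "X .<[ a , b ]>" := (X (enum_rank a) (enum_rank b))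
  (at level 2, format "X .<[ a ,  b ]>").

Definition moment_mx (x : 'cV[R]_N) (X : 'M[R]_N) : 'M[R]_(1 + N) :=
  block_mx 1 x^T x X.

Definition sdp_feasible (Omega : {set grid n}) (That : {a | a \in Omega} -> R)
    (x : 'cV[R]_N) (X : 'M[R]_N) : Prop :=
  [/\ X^T = X,
      forall a : {a | a \in Omega},
        x.<[val a]> = That a /\ X.<[val a, val a]> = That a ^+ 2,
      forall a1 a2 a3 a4, is_square a1 a2 a3 a4 ->
        X.<[a1, a2]> = X.<[a3, a4]>
    & psd (moment_mx x X)].

Definition sdp_objective (w : grid n -> R) (X : 'M[R]_N) : R :=
  \sum_b w b * X.<[b, b]>.

Definition sdp_optimal (Omega : {set grid n}) (That : {a | a \in Omega} -> R)
    (w : grid n -> R) (x : 'cV[R]_N) (X : 'M[R]_N) : Prop :=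
  sdp_feasible That x X /\
  forall y Y, sdp_feasible That y Y -> sdp_objective w X <= sdp_objective w Y.

Definition tensor_vec T : 'cV[R]_N := \col_i T (enum_val i).

Definition sdp_tight (Omega : {set grid n}) (That : {a | a \in Omega} -> R)
    (T : {ffun grid n -> R}) (w : grid n -> R) : Prop :=
  let xbar := tensor_vec T in
  sdp_optimal That w xbar (xbar *m xbar^T) /\
  forall x X, sdp_optimal That w x X ->
    moment_mx x X = moment_mx xbar (xbar *m xbar^T).

End Relaxation.

(* Main.v *)
Require Import Defs.
From mathcomp Require Import all_boot all_order all_algebra.
From mathcomp Require Import reals.
From mathcomp Require Import zify ring lra.

Set Implicit Arguments.
Unset Strict Implicit.
Unset Printing Implicit Defensive.

Import Order.TTheory GRing.Theory Num.Theory.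
Local Open Scope ring_scope.

(** Write [e_0] and [e_b] for the basis vectors of the moment matrix [M] of a
    feasible point, and [y b = e_b / T b - e_0] ([gap_vec]).  These vectors are
    killed by the matrix of the completion, so [gram b c = (y b)^T M (y c)]
    measures how far the feasible point is from it.  Put [Q b = gram b b >= 0]
    and [m b = x_b / T b - 1] ([moment_gap]).  Expanding the form,
      [X_(b,b) / T b ^ 2 = 1 + 2 m b + Q b],
    so the objective exceeds its value at the completion by
      [\sum_b w b * T b ^ 2 * (2 m b + Q b)],
    and only the linear terms [m b] can be negative.

    The linear terms are quadratically small.  For [b] in [Omega] the
    constraints say [Q b = 0] and [m b = 0]; then [y b] lies in the kernel of [M],
    and the squares used in SR-propagation give [m b = 0] on the whole
    SR-propagated set ([moment_gap0_SR]).  A square [{a1, a2; a3, b}] yields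
      [m b = m a1 + m a2 - m a3 + gram a1 a2 - gram a3 b] ([moment_gap_square]),
    and the products in [gram] are bounded by the values of [Q], the share of
    [Q b] being made as small as wanted (here 1/8) at the price of a larger
    constant before [Q a3].  By induction on the level,
      [`|m b| <= 9 ^ level b * \sum_(c of lower level) Q c + Q b / 8]
    ([propagated_bound]).  Thus [Q b] itself pays for 1/4 of the possible loss at
    [b], while the remaining loss, which carries the weight
    [theta ^ level b <= theta * theta ^ level c], is paid by the terms [Q c] of
    strictly lower level once [theta] is small ([weighted_coercive]).  So the
    excess is at least half of [\sum_b w b * T b ^ 2 * Q b]; it is nonnegative,
    and it vanishes only if every [Q b] does, which makes every [y b] a kernel
    vector of [M] and determines [M]. *)

(** * Positive semidefinite forms *)

Definition mxform (R : realType) p (A : 'M[R]_p) (u v : 'cV[R]_p) : R :=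
  (u^T *m A *m v) 0 0.

Lemma mxform_delta (R : realType) p (A : 'M[R]_p) i j :
  mxform A (delta_mx i 0) (delta_mx j 0) = A i j.
Proof. by rewrite /mxform trmx_delta -rowE -colE !mxE. Qed.

Lemma mxformDl (R : realType) p (A : 'M[R]_p) u u' v :
  mxform A (u + u') v = mxform A u v + mxform A u' v.
Proof. by rewrite /mxform linearD /= !mulmxDl mxE. Qed.

Lemma mxformDr (R : realType) p (A : 'M[R]_p) u v v' :
  mxform A u (v + v') = mxform A u v + mxform A u v'.
Proof. by rewrite /mxform mulmxDr mxE. Qed.

Lemma mxformZl (R : realType) p (A : 'M[R]_p) (a : R) u v :
  mxform A (a *: u) v = a * mxform A u v.
Proof. by rewrite /mxform linearZ /= -!scalemxAl mxE. Qed.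

Lemma mxformZr (R : realType) p (A : 'M[R]_p) (a : R) u v :
  mxform A u (a *: v) = a * mxform A u v.
Proof. by rewrite /mxform -scalemxAr mxE. Qed.

Lemma mxform_sym (R : realType) p (A : 'M[R]_p) u v :
  A^T = A -> mxform A u v = mxform A v u.
Proof.
move=> As; rewrite /mxform -[u^T *m A *m v]trmxK mxE.
by rewrite !trmx_mul trmxK As mulmxA.
Qed.

(** Young's inequality for the form: the sign of [a * b] is free, so this bounds
    [mxform A u v] on both sides, with adjustable shares. *)
Lemma psd_young (R : realType) p (A : 'M[R]_p) (u v : 'cV[R]_p) (a b : R) :
  psd A ->
  - 2 * a * b * mxform A u v <= a ^+ 2 * mxform A u u + b ^+ 2 * mxform A v v.
Proof.
move=> [As Ap]; have := Ap (a *: u + b *: v).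
rewrite -/(mxform A _ _) !mxformDl !mxformDr !mxformZl !mxformZr.
by rewrite (mxform_sym v u As) => H; lra.
Qed.

Lemma psd_isotropic (R : realType) p (A : 'M[R]_p) (u v : 'cV[R]_p) :
  psd A -> mxform A u u = 0 -> mxform A u v = 0.
Proof.
move=> Ap uu; apply/eqP/negPn/negP => ne.
have := psd_young u v (- (mxform A v v + 1) / (2 * mxform A u v)) 1 Ap.
have -> : - 2 * (- (mxform A v v + 1) / (2 * mxform A u v)) * 1 * mxform A u v
          = mxform A v v + 1 by field.
by rewrite uu; lra.
Qed.

(** * Weighted sums over levels *)

Section Levels.

Variables (R : realType) (I : finType) (lev : I -> nat).
Implicit Types (m Q c : I -> R).

Definition lower_sum Q (l : nat) : R := \sum_(a | (lev a < l)%N) Q a.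

(** One round of propagation along a square [{a1, a2; a3, b}].  The constants are
    those of Young's inequality for the products of [a1], [a2] and of [a3], [b];
    the share of [Q b] has to stay below 1/2, since [2 * m b] is to be absorbed
    by [Q b]. *)
Definition propagated_gap m Q : Prop :=
  forall b, lev b = 0%N /\ m b = 0 \/
    exists a1 a2 a3,
      [/\ (lev a1 < lev b)%N, (lev a2 < lev b)%N, (lev a3 < lev b)%N
        & `|m b| <= `|m a1| + `|m a2| + `|m a3|
                    + (Q a1 + Q a2) / 2 + 2 * Q a3 + Q b / 8].

Lemma lower_sum_ge0 Q l : (forall a, 0 <= Q a) -> 0 <= lower_sum Q l.
Proof. by move=> Q0; apply: sumr_ge0. Qed.

Lemma le_lower_sum Q l k :
  (forall a, 0 <= Q a) -> (l <= k)%N -> lower_sum Q l <= lower_sum Q k.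
Proof.
move=> Q0 lk; rewrite /lower_sum [leRHS](bigID (fun a => (lev a < l)%N)) /=.
rewrite [X in _ <= X + _](eq_bigl (fun a => (lev a < l)%N)) ?lerDl ?sumr_ge0 // => a.
by case: (ltnP (lev a) l) => [al|_]; [rewrite (leq_trans al lk) | rewrite andbF].
Qed.

Lemma term_le_lower_sum Q l a :
  (forall a, 0 <= Q a) -> (lev a < l)%N -> Q a <= lower_sum Q l.
Proof.
by move=> Q0 al; rewrite /lower_sum (bigD1 a) //= lerDl sumr_ge0.
Qed.

(** The constant 9: each of [`|m a1|], [`|m a2|], [`|m a3|] contributes at most
    [(9 ^ k + 1) * S] and the products at most [3 * S], where [S] is the sum of
    [Q] below level [k.+1]; and [3 * (9 ^ k + 1) + 3 <= 9 ^ k.+1]. *)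
Lemma propagated_bound m Q : (forall a, 0 <= Q a) -> propagated_gap m Q ->
  forall b, `|m b| <= 9 ^+ lev b * lower_sum Q (lev b) + Q b / 8.
Proof.
move=> Q0 prop b.
have [l] := ubnP (lev b); elim: l => // l IH in b *; rewrite ltnS => bl.
case: (prop b) => [[-> ->]|[a1 [a2 [a3 [l1 l2 l3 mb]]]]].
  by rewrite normr0 addr_ge0 ?mulr_ge0 ?exprn_ge0 ?lower_sum_ge0 // invr_ge0.
case: (lev b) => [|k] // in bl l1 l2 l3 *.
have S0 := lower_sum_ge0 k.+1 Q0; set S := lower_sum Q k.+1 in S0 *.
have mS a : (lev a < k.+1)%N -> `|m a| <= (9 ^+ k + 1) * S /\ Q a <= S.
  move=> ak; have QS : Q a <= S := term_le_lower_sum Q0 ak.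
  split=> //; apply: le_trans (IH a (leq_trans ak bl)) _.
  rewrite mulrDl lerD //; last by have := Q0 a; lra.
  apply: ler_pM; rewrite ?exprn_ge0 ?lower_sum_ge0 //.
    by rewrite ler_weXn2l // ler1n.
  by apply: le_lower_sum => //; apply: ltnW.
have [[m1 q1] [m2 q2]] := (mS _ l1, mS _ l2); have [m3 q3] := mS _ l3.
have pS : S <= 9 ^+ k * S by rewrite ler_peMl // exprn_ege1 // ler1n.
rewrite mulrDl mul1r in m1 m2 m3; rewrite exprS -mulrA.
by move: (9 ^+ k * S) pS m1 m2 m3 => P *; lra.
Qed.

(** A term of level [l] loses at most a multiple of the quadratic terms of lower
    level, and its weight is smaller than theirs by a factor [theta]. *)
Lemma weighted_coercive c : (forall b, 0 < c b) ->
  exists t : R, 0 < t < 1 /\ forall (theta : R) m Q, 0 < theta < t ->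
    (forall b, 0 <= Q b) -> propagated_gap m Q ->
    (\sum_b theta ^+ lev b * c b * Q b) / 2
      <= \sum_b theta ^+ lev b * c b * (2 * m b + Q b).
Proof.
move=> c0; pose K := \sum_b c b * 2 * 9 ^+ lev b.
have k0 b : 0 <= c b * 2 * 9 ^+ lev b.
  by rewrite mulr_ge0 ?exprn_ge0 // mulr_ge0 // ltW.
have K0 : 0 <= K by apply: sumr_ge0.
(* [t] is chosen so that [theta < t] gives [theta * K <= c a / 4] for all [a] *)
pose D := 2 + \sum_a 4 * K / c a.
have r0 a : 0 <= 4 * K / c a by rewrite divr_ge0 ?mulr_ge0 // ltW.
have D2 : 2 <= D by rewrite lerDl sumr_ge0.
have D0 : 0 < D by lra.
exists D^-1; split; first by rewrite invr_gt0 D0 invf_lt1 //; lra.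
move=> theta m Q /andP[th0 tht] Q0 prop.
have tD : theta * D < 1 by rewrite -ltr_pdivlMr // mul1r.
have th1 : theta < 1 by apply: le_lt_trans tD; rewrite ler_peMr ?ltW //; lra.
have tK a : theta * K <= c a / 4.
  have : theta * (4 * K / c a) <= 1.
    apply: le_trans (ltW tD); rewrite ler_wpM2l ?ltW // /D (bigD1 a) //=.
    by have : 0 <= \sum_(i | i != a) 4 * K / c i; [exact: sumr_ge0 | lra].
  by rewrite !mulrA ler_pdivrMr // mul1r; lra.
have tp l : 0 < theta ^+ l by apply: exprn_gt0.
have loss : \sum_b theta ^+ lev b * (c b * 2 * 9 ^+ lev b) * lower_sum Q (lev b)
    <= \sum_a theta ^+ lev a * c a * Q a / 4.
  rewrite /lower_sum.
  under eq_bigr do rewrite mulr_sumr big_mkcond /=.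
  rewrite exchange_big /=; apply: ler_sum => a _.
  apply: (@le_trans _ _ (theta ^+ lev a * Q a * (theta * K))); last first.
    have := tK a; have : 0 <= theta ^+ lev a * Q a by rewrite mulr_ge0 // ltW.
    by move: (theta * K) => x q0 h; have := ler_wpM2l q0 h; lra.
  rewrite /K !mulr_sumr; apply: ler_sum => b _.
  have pow : (lev a < lev b)%N -> theta ^+ lev b <= theta ^+ (lev a).+1.
    by move=> ab; rewrite ler_wiXn2l // ltW.
  case: ltnP => [/pow|_]; last first.
    by apply: mulr_ge0; apply: mulr_ge0; rewrite ?k0 ?Q0 // ltW.
  rewrite exprSr => /(ler_wpM2r (mulr_ge0 (k0 b) (Q0 a))) h.
  by move: h; congr (_ <= _); ring.
have gain b : theta ^+ lev b * c b * Q b * (3 / 4)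
    <= theta ^+ lev b * c b * (2 * m b + Q b)
       + theta ^+ lev b * (c b * 2 * 9 ^+ lev b) * lower_sum Q (lev b).
  have := propagated_bound Q0 prop b; have := ler_norm (- m b); rewrite normrN.
  move: (9 ^+ lev b) (lower_sum _ _) (`|m b|) => p S nm h1 h2.
  have tc : 0 <= theta ^+ lev b * c b by rewrite mulr_ge0 // ltW.
  have h : 3 / 4 * Q b <= 2 * m b + Q b + 2 * (p * S) by lra.
  by have := ler_wpM2l tc h; lra.
have := ler_sum (index_enum I) (P := predT) (fun b _ => gain b).
rewrite big_split /= -mulr_suml; move: loss; rewrite -mulr_suml; lra.
Qed.

End Levels.

(** * Levels of the weight generation *)

Section Stages.

Variables (d : nat) (n : 'I_d -> nat).
Implicit Types (Omega : {set grid n}) (a b : grid n).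

Lemma sub_SR_propagated Omega : Omega \subset SR_propagated Omega.
Proof. by apply/bigcapsP => P /andP[]. Qed.

(** The stages stop growing within [#|grid n|] rounds, and a stage at which they
    stop is closed under S-propagation. *)
Lemma stage_setT Omega :
  S_propagation Omega -> stage Omega #|{: grid n}| = setT.
Proof.
move=> OS; set S := stage _ _.
have stop : S_step S = set0.
  by apply/eqP/negPn/negP => /stage_card; rewrite ltnNge max_card.
apply/eqP; rewrite -subTset -OS /S_propagated.
apply: bigcap_inf; apply/andP; split.
  exact: subset_trans (sub_SR_propagated Omega) (stage_sub Omega (leq0n _)).
apply/forall_inP => a1 S1; apply/forall_inP => a2 S2; apply/forall_inP => a3 S3.
apply/forallP => b; apply/implyP => sq; apply/negPn/negP => bS.
have : b \in S_step S.
  rewrite inE bS; apply/exists_inP; exists a1 => //.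
  by apply/exists_inP; exists a2 => //; apply/exists_inP; exists a3.
by rewrite stop inE.
Qed.

Lemma level_leq Omega l b : (l <= #|{: grid n}|)%N ->
  b \in stage Omega l -> (level Omega b <= l)%N.
Proof.
move=> lN bl; rewrite leqNgt; apply/negP => /(before_find 0%N).
by rewrite nth_iota // add0n bl.
Qed.

Lemma in_stage_level Omega b :
  S_propagation Omega -> b \in stage Omega (level Omega b).
Proof.
move=> OS; have h : has (fun l => b \in stage Omega l) (iota 0 #|{: grid n}|.+1).
  by apply/hasP; exists #|{: grid n}|; rewrite ?mem_iota //= stage_setT ?inE.
have := nth_find 0%N h; rewrite nth_iota //.
by move: h; rewrite has_find size_iota.
Qed.

Lemma level_step Omega b : S_propagation Omega -> (0 < level Omega b)%N ->
  exists a1 a2 a3, [/\ (level Omega a1 < level Omega b)%N,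
    (level Omega a2 < level Omega b)%N, (level Omega a3 < level Omega b)%N
    & is_square a1 a2 a3 b].
Proof.
move=> OS; have bl := in_stage_level b OS.
have lN : (level Omega b <= #|{: grid n}|)%N by apply: level_leq; rewrite ?stage_setT ?inE.
case E : (level Omega b) bl lN => [//|l] bl lN _.
have : b \in S_step (stage Omega l).
  move: bl; rewrite [stage _ _]iterS in_setU => /orP[|//].
  by move=> /(level_leq (ltnW lN)); rewrite E ltnn.
rewrite inE => /andP[_] /exists_inP[a1 S1] /exists_inP[a2 S2] /exists_inP[a3 S3] sq.
by exists a1, a2, a3; split=> //; rewrite ltnS level_leq // ltnW.
Qed.

End Stages.

(** * Rank-one tensors *)

Lemma square_mul (R : realType) d (n : 'I_d -> nat) (T : {ffun grid n -> R})
    (a1 a2 a3 a4 : grid n) :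
  rank_one T -> is_square a1 a2 a3 a4 -> T a1 * T a2 = T a3 * T a4.
Proof.
move=> [_ [u Tu]] /andP[_ /forallP sq]; rewrite !Tu -!big_split /=.
apply: eq_bigr => k _; have /andP[/eqP mx /eqP mn] := sq k.
(* equal maximum and minimum: the same two indices, up to order *)
have [[/val_inj-> /val_inj->] //|[/val_inj-> /val_inj->]] :
    (a1 k = a3 k :> nat /\ a2 k = a4 k :> nat) \/
    (a1 k = a4 k :> nat /\ a2 k = a3 k :> nat) by lia.
by rewrite mulrC.
Qed.

Lemma completion_neq0 (R : realType) d (n : 'I_d -> nat) (Omega : {set grid n})
    (That : {a | a \in Omega} -> R) (T : {ffun grid n -> R}) :
  rank_one_completion That T -> S_propagation Omega ->
  (forall a, That a != 0) -> forall b, T b != 0.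
Proof.
move=> [T1 TO] OS That0 b.
suff : setT \subset [set c | T c != 0] by move/subsetP/(_ b); rewrite !inE => ->.
rewrite -OS; apply: bigcap_inf; apply/andP; split.
  by apply/subsetP => a aO; rewrite inE -[a]/(val (exist _ a aO)) TO.
apply/forall_inP => a1; rewrite inE => T1n; apply/forall_inP => a2.
rewrite inE => T2n; apply/forall_inP => a3 _.
apply/forallP => c; apply/implyP => /(square_mul T1) E; rewrite inE.
by apply: contraNneq (mulf_neq0 T1n T2n) => c0; rewrite E c0 mulr0.
Qed.

(** * The gap to the completion *)

Section Gap.

Variables (R : realType) (d : nat) (n : 'I_d -> nat).
Local Notation N := #|{: grid n}|.
Variables (Omega : {set grid n}) (That : {a | a \in Omega} -> R).
Variables (T : {ffun grid n -> R}).
Implicit Types (x : 'cV[R]_N) (X : 'M[R]_N) (a b c : grid n).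

Definition gap_vec b : 'cV[R]_(1 + N) :=
  (T b)^-1 *: delta_mx (rshift 1 (enum_rank b)) 0 - delta_mx (lshift N 0) 0.

Definition gram x X b c : R := mxform (moment_mx x X) (gap_vec b) (gap_vec c).

Definition moment_gap x b : R := x (enum_rank b) 0 / T b - 1.

Lemma gramE x X b c : gram x X b c =
  X (enum_rank b) (enum_rank c) / (T b * T c) - moment_gap x b - moment_gap x c - 1.
Proof.
rewrite /gram /gap_vec -!scaleN1r !mxformDl !mxformDr !mxformZl !mxformZr.
rewrite !mxform_delta /moment_mx block_mxEul block_mxEur block_mxEdl block_mxEdr.
by rewrite !mxE /moment_gap invfM /=; ring.
Qed.

Lemma sdp_objective_gap (w : grid n -> R) x X : (forall b, T b != 0) ->
  sdp_objective w X =
  sdp_objective w (tensor_vec T *m (tensor_vec T)^T)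
  + \sum_b w b * T b ^+ 2 * (2 * moment_gap x b + gram x X b b).
Proof.
move=> T0; rewrite /sdp_objective -big_split /=; apply: eq_bigr => b _.
rewrite gramE !mxE big_ord1 !mxE enum_rankK; field; exact: T0.
Qed.

Lemma tensor_feasible :
  rank_one_completion That T ->
  sdp_feasible That (tensor_vec T) (tensor_vec T *m (tensor_vec T)^T).
Proof.
move=> [T1 TO]; split.
- by rewrite trmx_mul trmxK.
- by move=> a; rewrite !mxE big_ord1 !mxE !enum_rankK TO expr2.
- move=> a1 a2 a3 a4 sq; rewrite !mxE !big_ord1 !mxE !enum_rankK.
  exact: square_mul T1 sq.
set y := tensor_vec T.
have -> : moment_mx y (y *m y^T) = col_mx 1 y *m (col_mx 1 y)^T.
  by rewrite tr_col_mx mul_col_row trmx1 !mul1mx mulmx1.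
split=> [|v]; first by rewrite trmx_mul trmxK.
rewrite mulmxA -mulmxA -[v^T *m _]trmxK trmx_mul trmxK mxE big_ord1 !mxE.
exact: sqr_ge0.
Qed.

Section Feasible.

Variables (x : 'cV[R]_N) (X : 'M[R]_N).
Hypotheses (T1 : rank_one_completion That T) (T0 : forall b, T b != 0).
Hypothesis (xX : sdp_feasible That x X).

Local Notation m := (moment_gap x).
Local Notation B := (gram x X).

Let Mpsd : psd (moment_mx x X). Proof. by case: xX. Qed.

Lemma gram_ge0 b : 0 <= B b b.
Proof. by case: Mpsd => _; apply. Qed.

Lemma gram_isotropic b c : B b b = 0 -> B b c = 0.
Proof. exact: psd_isotropic. Qed.

Lemma moment_gap_Omega a : a \in Omega -> m a = 0 /\ B a a = 0.
Proof.
move=> aO; case: xX => _ /(_ (exist _ a aO))[/= xa Xa] _ _.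
have ma : m a = 0.
  by rewrite /moment_gap xa -(T1.2 (exist _ a aO)) divff ?subrr // T0.
split=> //; rewrite gramE ma Xa -(T1.2 (exist _ a aO)) -expr2 divff ?expf_neq0 //.
by rewrite !subr0 subrr.
Qed.

(** The quotients [X_(b,c) / (T b * T c)] agree on the two sides of a square,
    because the products of [T] do. *)
Lemma moment_gap_square a1 a2 a3 b : is_square a1 a2 a3 b ->
  m b = m a1 + m a2 - m a3 + B a1 a2 - B a3 b.
Proof.
move=> sq; case: xX => _ _ /(_ _ _ _ _ sq) XE _.
by rewrite !gramE XE (square_mul T1.1 sq); ring.
Qed.

(** In the squares of SR-propagation, the entries of [gram] belong to [Omega] on
    one side, hence vanish. *)
Lemma moment_gap0_SR b : b \in SR_propagated Omega -> m b = 0.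
Proof.
suff : SR_propagated Omega \subset [set c | m c == 0].
  by move/subsetP/(_ b) => /[apply]; rewrite inE => /eqP.
apply: bigcap_inf; apply/andP; split.
  by apply/subsetP => a /moment_gap_Omega[ma _]; rewrite inE ma.
apply/forall_inP => a1 /moment_gap_Omega[m1 B1].
apply/forall_inP => a2 /moment_gap_Omega[m2 B2].
apply/forall_inP => c; rewrite inE => /eqP mc.
apply/forallP => e; apply/implyP => sq.
rewrite inE (moment_gap_square sq) m1 m2 mc.
by rewrite (gram_isotropic _ B1) (gram_isotropic _ B2) !subr0 !addr0.
Qed.

Lemma propagated_feasible : S_propagation Omega ->
  propagated_gap (level Omega) m (fun b => B b b).
Proof.
move=> OS b; case: (posnP (level Omega b)) => [l0|lb].
  left; split=> //; apply: moment_gap0_SR.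
  by have := in_stage_level b OS; rewrite l0.
right; have [a1 [a2 [a3 [l1 l2 l3 sq]]]] := level_step OS lb.
exists a1, a2, a3; split=> //; rewrite (moment_gap_square sq).
have y12 (s : R) := psd_young (gap_vec a1) (gap_vec a2) s 1 Mpsd.
(* shares 2 and 1/8 for [a3] and [b] *)
have y3b (s : R) := psd_young (gap_vec a3) (gap_vec b) s (1 / 2) Mpsd.
have := y12 1; have := y12 (- 1); have := y3b 2; have := y3b (- 2).
rewrite -!/(gram _ _ _ _) => u1 u2 u3 u4.
have := ler_norm (m a1); have := ler_norm (- m a1).
have := ler_norm (m a2); have := ler_norm (- m a2).
have := ler_norm (m a3); have := ler_norm (- m a3).
by rewrite !normrN ler_norml => *; apply/andP; split; lra.
Qed.

(** Isotropic vectors of a positive semidefinite form lie in its kernel, and the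
    [gap_vec b] together with [e_0] span the space, so [M] is determined. *)
Lemma gram0_moment_mx : (forall b, m b = 0) -> (forall b, B b b = 0) ->
  moment_mx x X = moment_mx (tensor_vec T) (tensor_vec T *m (tensor_vec T)^T).
Proof.
move=> m0 B0.
have xE : x = tensor_vec T.
  apply/colP => i; rewrite mxE; have := m0 (enum_val i).
  by rewrite /moment_gap enum_valK => /eqP; rewrite subr_eq0 => /eqP/divr1_eq.
suff <- : X = tensor_vec T *m (tensor_vec T)^T by rewrite -xE.
apply/matrixP => i j; rewrite !mxE big_ord1 !mxE.
have := gram_isotropic (enum_val j) (B0 (enum_val i)).
rewrite gramE !m0 !enum_valK !subr0 => /eqP; rewrite subr_eq0 => /eqP.
exact: divr1_eq.
Qed.

End Feasible.

End Gap.

(** * Tightness for small weight ratios *)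

Theorem theorem5 (R : realType) (d : nat) (n : 'I_d -> nat)
    (d_gt0 : (0 < d)%N) (n_gt0 : forall k, (0 < n k)%N)
    (Omega : {set grid n}) (That : {a : grid n | a \in Omega} -> R)
    (T : {ffun grid n -> R})
    (T_unique : unique (rank_one_completion That) T)
    (Omega_S : S_propagation Omega)
    (That_neq0 : forall a, That a != 0) :
  exists t : R, 0 < t < 1 /\
    forall theta : R, 0 < theta < t ->
      sdp_tight That T (weights Omega theta).
Proof.
have T1 := T_unique.1; have T0 := completion_neq0 T1 Omega_S That_neq0.
have T2 b : 0 < T b ^+ 2 by rewrite exprn_even_gt0 //= T0.
have [t [t01 coercive]] := weighted_coercive (level Omega) T2.
exists t; split=> // theta th.
have [th0 _] := andP th.
have w0 b : 0 < weights Omega theta b * T b ^+ 2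
  by apply: mulr_gt0 => //; apply: exprn_gt0.
set w := weights Omega theta in w0 *.
have excess x X : sdp_feasible That x X ->
    sdp_objective w (tensor_vec T *m (tensor_vec T)^T)
    + (\sum_b w b * T b ^+ 2 * gram T x X b b) / 2 <= sdp_objective w X.
  move=> xX; rewrite (sdp_objective_gap w x X T0) lerD2l.
  apply: coercive => // [b|]; first exact: gram_ge0 xX b.
  exact: propagated_feasible T1 T0 xX Omega_S.
have term_ge0 x X : sdp_feasible That x X ->
    forall b, 0 <= w b * T b ^+ 2 * gram T x X b b.
  by move=> xX b; rewrite mulr_ge0 ?(ltW (w0 b)) ?(gram_ge0 _ xX).
have sum_ge0 x X : sdp_feasible That x X ->
    0 <= \sum_b w b * T b ^+ 2 * gram T x X b b.
  by move=> xX; apply: sumr_ge0 => b _; apply: term_ge0.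
split.
  split=> [|y Y yY]; first exact: tensor_feasible.
  by have := excess _ _ yY; have := sum_ge0 _ _ yY; lra.
move=> x X [xX opt].
have s0 : \sum_b w b * T b ^+ 2 * gram T x X b b = 0.
  have := excess _ _ xX; have := opt _ _ (tensor_feasible T1).
  by have := sum_ge0 _ _ xX; lra.
have B0 b : gram T x X b b = 0.
  have /(_ b isT)/eqP := psumr_eq0P (fun b _ => term_ge0 _ _ xX b) s0.
  by rewrite mulf_eq0 gt_eqF //= => /eqP.
apply: (gram0_moment_mx xX) => // b.
have := propagated_bound (gram_ge0 T xX) (propagated_feasible T1 T0 xX Omega_S) b.
by rewrite /lower_sum big1 // B0 mulr0 mul0r addr0 normr_le0 => /eqP.
Qed.
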